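(* Let $\mathbb{K}$ be a field and $R=\mathbb{K}[x_1,\dots,x_n]$. Let $I\subset R$ be an unmixed ass-decomposable monomial ideal. Then $R/I$ is Cohen-Macaulay.
   Context: For an ideal $I\subseteq R$, $\mathrm{ass}(I)$ is the set of associated primes of $R/I$. An ideal $I$ is unmixed if $\dim R/I=\dim R/\mathfrak{p}$ for all $\mathfrak{p}\in\mathrm{ass}(I)$. Recursively, a (proper) monomial ideal $I\subset R$ is called ass-decomposable if either it is a primary ideal, or else there exist a variable $x_i\notin\sqrt{I}$ and a positive integer $k$ such that (i) $\mathrm{ass}(I+(x_i^k))=\{\mathfrak{p}\in\mathrm{ass}(I) : x_i\in\mathfrak{p}\}$, and (ii) both $I+(x_i^k)$ and $I:x_i^k$ are ass-decomposable. Cohen-Macaulay means $\mathrm{depth}(R/I)=\dim(R/I)$, with depth taken with respect to $\mathfrak{m}=(x_1,\dots,x_n)$. *)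

(* Defs.v *)
From HB Require Import structures.
From mathcomp Require Import all_boot all_order all_algebra.
From mathcomp Require Import boolp classical_sets.
From mathcomp Require Import mpoly.

Set Implicit Arguments.
Unset Strict Implicit.
Unset Printing Implicit Defensive.

Import GRing.Theory.
Local Open Scope classical_set_scope.
Local Open Scope ring_scope.

(* Subsets are Prop-valued, since ideal membership need not be decidable;    *)
(* the library's idealr is boolean and excludes the unit ideal.              *)
Section CommutativeAlgebra.
Context {R : comNzRingType}.
Implicit Types (I J P : set R) (f g : R) (s : seq R).

Definition ideal I : Prop :=
  [/\ I 0, forall f g, I f -> I g -> I (f + g) & forall f g, I g -> I (f * g)].

Definition ideal_gen (S : set R) : set R := smallest ideal S.

Definition ideal_add I J : set R := [set f + g | f in I & g in J].

Definition ideal_colon I f : set R := [set g | I (g * f)].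

Definition radical I : set R := [set f | exists k : nat, I (f ^+ k)].

Definition proper_ideal I : Prop := ideal I /\ ~ I 1.

Definition prime_ideal P : Prop :=
  proper_ideal P /\ forall f g, P (f * g) -> P f \/ P g.

Definition primary_ideal I : Prop :=
  proper_ideal I /\ forall f g, I (f * g) -> I f \/ radical I g.

(* The colon ideal (I : f) is the annihilator of the class of f in R/I. *)
Definition ass I : set (set R) :=
  [set P | prime_ideal P /\ exists f, P = ideal_colon I f].

Definition is_max (L : set nat) (d : nat) : Prop :=
  L d /\ forall e, L e -> (e <= d)%N.

(* Primes of R/I are the primes of R containing I. *)
Definition prime_chain I (d : nat) : Prop :=
  exists P : nat -> set R,
    (forall i, (i <= d)%N -> prime_ideal (P i) /\ I `<=` P i) /\
    (forall i, (i < d)%N -> P i `<` P i.+1).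

(* dim R/I = d *)
Definition quot_dim I (d : nat) : Prop := is_max (prime_chain I) d.

(* s is a regular sequence on the R-module R/I *)
Definition regular_seq I s : Prop :=
  let A i := ideal_add I (ideal_gen [set` take i s]) in
  (forall i, (i < size s)%N -> forall g, A i (s`_i * g) -> A i g) /\
  ~ A (size s) 1.

(* depth of R/I with respect to J is d *)
Definition quot_depth J I (d : nat) : Prop :=
  is_max [set r | exists s, [/\ size s = r, [set` s] `<=` J & regular_seq I s]] d.

(* Equality of dimensions, without presupposing that they are finite. *)
Definition unmixed I : Prop :=
  forall P, ass I P -> forall d, quot_dim I d <-> quot_dim P d.

End CommutativeAlgebra.

Section MonomialIdeals.
Context {K : fieldType} {n : nat}.
Implicit Type I : set {mpoly K[n]}.

Definition monomial_ideal I : Prop :=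
  exists M : set 'X_{1..n}, I = ideal_gen [set 'X_[m] | m in M].

Definition max_ideal : set {mpoly K[n]} := ideal_gen [set 'X_i | i in setT].

Inductive ass_decomposable : set {mpoly K[n]} -> Prop :=
| AssDecPrimary I of monomial_ideal I & primary_ideal I : ass_decomposable I
| AssDecSplit I (i : 'I_n) (k : nat) of
    monomial_ideal I & proper_ideal I & ~ radical I 'X_i & (0 < k)%N &
    ass (ideal_add I (ideal_gen [set 'X_i ^+ k])) =
      ass I `&` [set P | P 'X_i] &
    ass_decomposable (ideal_add I (ideal_gen [set 'X_i ^+ k])) &
    ass_decomposable (ideal_colon I ('X_i ^+ k)) : ass_decomposable I.

Definition cohen_macaulay I : Prop :=
  exists d, quot_depth max_ideal I d /\ quot_dim I d.

End MonomialIdeals.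

(* Main.v *)
Require Import Defs.
From mathcomp Require Import all_boot all_order all_algebra.
From mathcomp Require Import boolp classical_sets.
From mathcomp Require Import mpoly.
From mathcomp Require Import ring zify.

(** Cohen-Macaulayness is proved by exhibiting one sequence that is regular on
    R/I for every unmixed ass-decomposable I of dimension d: the elementary
    symmetric polynomials e_d, ..., e_1 in all n variables.

    Why one sequence for all ideals: regularity of a fixed sequence passes from
    both ends of 0 -> R/(I : u) -> R/I -> R/(I + (u)) -> 0 to the middle
    ([weakly_regular_exact]), by the snake lemma, without any theory of depth.
    An ass-decomposition of I therefore reduces the claim to primary monomial
    ideals. Their radicals are associated primes of I, hence of dimension d by
    unmixedness: the sums I + (x_i^k) create no new associated primes by
    definition, and the colons never do ([weakly_regular_ass_decomposable]). The
    same exact sequences, with u a variable, reduce a primary monomial ideal to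
    its radical ([primary_exponents_ind]), which is generated by n - d
    variables.

    Modulo such a prime, R becomes a polynomial ring S in d variables y_1, ...,
    y_d and e_k becomes the k-th elementary symmetric polynomial of the y_j. In
    particular e_d becomes the product of the y_j; it is regular, and S/(e_d) is
    filtered by the rings S/(y_j), which are polynomial rings in d - 1
    variables. Induction on d finishes ([weakly_regular_coordinate_prime]). The
    sequence is not linear because over a finite field no linear sequence need
    serve all the coordinate primes.

    Dimensions are computed from scratch. A chain of n + 2 primes in n
    variables would yield n + 1 algebraically independent polynomials, which
    counting monomials excludes ([prime_chain_length]); this gives the
    dimension n - #|F| of the prime generated by the variables of F, and
    hence, through an associated prime of that form, the dimension d of R/I.
    Finally a regular sequence of length r yields a chain of primes of length
    r ([weakly_regular_chain]), so no regular sequence is longer than d. *)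

Set Implicit Arguments.
Unset Strict Implicit.
Unset Printing Implicit Defensive.

Import GRing.Theory.
Local Open Scope classical_set_scope.
Local Open Scope ring_scope.

(** * Ideals and weakly regular sequences *)

Section Ideals.
Context {R : comNzRingType}.
Implicit Types (I J P Q S : set R) (a b f g u : R) (s : seq R).

Definition add_principal I a : set R :=
  [set f | exists g h, I g /\ f = g + h * a].

Lemma idealB I f g : ideal I -> I f -> I g -> I (f - g).
Proof.
by case=> _ ID IM If Ig; rewrite -mulN1r; apply: ID => //; apply: IM.
Qed.

Lemma ideal_sum I (T : Type) (r : seq T) (p : pred T) (F : T -> R) :
  ideal I -> (forall x, p x -> I (F x)) -> I (\sum_(x <- r | p x) F x).
Proof. by case=> I0 ID _ IF; apply: big_ind. Qed.

Lemma ideal_prod I (T : finType) (p : pred T) (F : T -> R) x :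
  ideal I -> p x -> I (F x) -> I (\prod_(y | p y) F y).
Proof. by case=> _ _ IM px IFx; rewrite (bigD1 x) //= mulrC; apply: IM. Qed.

Lemma ideal_add_principal I a : ideal I -> ideal (add_principal I a).
Proof.
case=> I0 ID IM; split.
- by exists 0, 0; rewrite mul0r addr0.
- move=> _ _ [f [h [If ->]]] [g [k [Ig ->]]].
  by exists (f + g), (h + k); split; [apply: ID | ring].
- move=> f _ [g [h [Ig ->]]].
  by exists (f * g), (f * h); split; [apply: IM | ring].
Qed.

Lemma sub_add_principal I a : I `<=` add_principal I a.
Proof. by move=> f If; exists f, 0; rewrite mul0r addr0. Qed.

Lemma mem_add_principal I a : ideal I -> add_principal I a a.
Proof. by case=> I0 _ _; exists 0, 1; rewrite mul1r add0r. Qed.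

Lemma add_principal_sub I J a :
  ideal J -> I `<=` J -> J a -> add_principal I a `<=` J.
Proof.
case=> _ JD JM IJ Ja _ [g [h [Ig ->]]].
by apply: JD; [apply: IJ | apply: JM].
Qed.

Lemma add_principalC I a b :
  add_principal (add_principal I a) b = add_principal (add_principal I b) a.
Proof.
suff sub c d : add_principal (add_principal I c) d `<=`
    add_principal (add_principal I d) c by apply/seteqP.
move=> _ [_ [h [[g [k [Ig ->]]] ->]]].
by exists (g + h * d), k; split; [exists g, h | ring].
Qed.

Lemma add_principal_congr I a b :
  ideal I -> I (a - b) -> add_principal I a = add_principal I b.
Proof.
move=> idI; have [_ ID IM] := idI => Iab; apply/seteqP.
split=> _ [g [h [Ig ->]]].
  exists (g + h * (a - b)), h; split; last by ring.
  by apply: ID => //; apply: IM.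
exists (g - h * (a - b)), h; split; last by ring.
by apply: idealB => //; apply: IM.
Qed.

Lemma ideal_colonM I f g :
  ideal_colon (ideal_colon I f) g = ideal_colon I (g * f).
Proof. by apply/seteqP; split=> h; rewrite /ideal_colon /= mulrA. Qed.

Lemma ass_sub I P : ideal I -> ass I P -> I `<=` P.
Proof.
by move=> [_ _ IM] [_ [f ->]] g Ig; rewrite /ideal_colon /= mulrC; apply: IM.
Qed.

Lemma ass_colon I u : ass (ideal_colon I u) `<=` ass I.
Proof.
by move=> P [primeP [f EP]]; split=> //; exists (f * u); rewrite -ideal_colonM.
Qed.

Lemma radical_primary I f g : primary_ideal I ->
  radical I (f * g) -> radical I f \/ radical I g.
Proof.
case=> _ primI [k]; rewrite exprMn => /primI[If|[l Ig]].
  by left; exists k.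
by right; exists (k * l)%N; rewrite exprM.
Qed.

Lemma ideal_ideal_gen (S : set R) : ideal (ideal_gen S).
Proof.
split.
- by move=> J [[]].
- move=> f g Sf Sg J HJ; have [[_ JD _] _] := HJ.
  by apply: JD; [exact: Sf | exact: Sg].
- by move=> f g Sg J HJ; have [[_ _ JM] _] := HJ; apply: JM; apply: Sg.
Qed.

Lemma mem_ideal_gen (S : set R) : S `<=` ideal_gen S.
Proof. by move=> f Sf J [_]; apply. Qed.

Lemma ideal_gen_sub (S : set R) J : ideal J -> S `<=` J -> ideal_gen S `<=` J.
Proof. by move=> idJ SJ f; apply. Qed.

Lemma ideal_ideal_add I J : ideal I -> ideal J -> ideal (ideal_add I J).
Proof.
case=> I0 ID IM [J0 JD JM]; split.
- by exists 0 => //; exists 0 => //; rewrite addr0.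
- move=> _ _ [f If [g Jg <-]] [f' If' [g' Jg' <-]].
  by exists (f + f'); [apply: ID | exists (g + g'); [apply: JD | ring]].
- move=> h _ [f If [g Jg <-]].
  by exists (h * f); [apply: IM | exists (h * g); [apply: JM | ring]].
Qed.

Lemma ideal_add_sub I J Q :
  ideal Q -> I `<=` Q -> J `<=` Q -> ideal_add I J `<=` Q.
Proof. by case=> _ QD _ IQ JQ _ [f If [g Jg <-]]; apply: QD; auto. Qed.

Lemma ideal_add_subl I J : ideal J -> I `<=` ideal_add I J.
Proof. by case=> J0 _ _ f If; exists f => //; exists 0; rewrite ?addr0. Qed.

Lemma ideal_add_subr I J : ideal I -> J `<=` ideal_add I J.
Proof. by case=> I0 _ _ f Jf; exists 0 => //; exists f; rewrite ?add0r. Qed.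

Lemma ideal_add_gen_cons I a s : ideal I ->
  ideal_add I (ideal_gen [set` a :: s]) =
  ideal_add (add_principal I a) (ideal_gen [set` s]).
Proof.
move=> idI; have idIa := ideal_add_principal a idI.
have idg := ideal_ideal_gen.
apply/seteqP; split; apply: ideal_add_sub; try exact: ideal_ideal_add.
- by move=> f If; apply/(ideal_add_subl (idg _))/sub_add_principal.
- apply: ideal_gen_sub; first exact: ideal_ideal_add.
  move=> f /=; rewrite inE => /predU1P[->|fs].
    exact/(ideal_add_subl (idg _))/mem_add_principal.
  by apply: (ideal_add_subr idIa); apply: mem_ideal_gen.
- apply: add_principal_sub; first exact: ideal_ideal_add.
    exact: ideal_add_subl.
  by apply: (ideal_add_subr idI); apply: mem_ideal_gen; rewrite /= mem_head.
- apply: ideal_gen_sub; first exact: ideal_ideal_add.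
  move=> f fs; apply: (ideal_add_subr idI); apply: mem_ideal_gen.
  by rewrite /= inE; apply/orP; right.
Qed.

Lemma ideal_add_gen0 I : ideal I -> ideal_add I (ideal_gen [set` [::]]) = I.
Proof.
move=> idI; apply/seteqP; split; last exact/ideal_add_subl/ideal_ideal_gen.
by apply: ideal_add_sub => //; apply: ideal_gen_sub.
Qed.

Lemma ideal_add_gen1 I a : ideal I ->
  ideal_add I (ideal_gen [set a]) = add_principal I a.
Proof.
move=> idI; rewrite (_ : [set a] = [set` [:: a]]); last first.
  by apply/seteqP; split=> x /=; rewrite inE => /eqP.
rewrite ideal_add_gen_cons // ideal_add_gen0 //; exact: ideal_add_principal.
Qed.

(** The properness clause of a regular sequence is dropped, so that colon
    ideals equal to the whole ring cause no case distinctions, and the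
    recursion absorbs one element at a time into the ideal, which makes
    induction direct. *)
Fixpoint weakly_regular I s : Prop :=
  if s is a :: s' then
    (forall g, I (a * g) -> I g) /\ weakly_regular (add_principal I a) s'
  else True.

Lemma regular_seqE I s : ideal I ->
  regular_seq I s <->
  weakly_regular I s /\ ~ ideal_add I (ideal_gen [set` s]) 1.
Proof.
rewrite /regular_seq => idI /=; rewrite take_size.
suff H : (forall i, (i < size s)%N -> forall g,
    ideal_add I (ideal_gen [set` take i s]) (s`_i * g) ->
    ideal_add I (ideal_gen [set` take i s]) g) <-> weakly_regular I s.
  by split=> -[/H].
elim: s I idI => [|a s IH] I idI //=.
have /IH {}IH := ideal_add_principal a idI; rewrite -IH; split.
- move=> H; split; first by move/(_ 0%N isT): H => /=; rewrite ideal_add_gen0.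
  by move=> i lt_is; move/(_ i.+1 lt_is): H => /=; rewrite ideal_add_gen_cons.
- case=> H0 H [|i] lt_is /=; first by rewrite ideal_add_gen0.
  by rewrite ideal_add_gen_cons //; apply: H.
Qed.

(** The snake lemma at work: u induces 0 -> R/(I : u) -> R/I -> R/(I + (u))
    -> 0, and reducing this sequence modulo a stays exact on the left
    precisely because a is regular on the third term. *)
Lemma colon_add_principal I a u : ideal I ->
  (forall g, add_principal I u (a * g) -> add_principal I u g) ->
  ideal_colon (add_principal I a) u = add_principal (ideal_colon I u) a.
Proof.
move=> idI nzd; have [I0 ID IM] := idI; apply/seteqP; split.
  move=> g [i [h [Ii Eg]]].
  have /nzd[i' [h' [Ii' Eh]]] : add_principal I u (a * h).
    exists (- i), g; split; first by rewrite -sub0r; apply: idealB.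
    by rewrite Eg; ring.
  exists (g - h' * a), h'; split; last by ring.
  rewrite /ideal_colon /= mulrBl Eg Eh.
  by rewrite (_ : _ - _ = i + a * i'); [apply: ID => //; apply: IM | ring].
move=> _ [g [h [Ig ->]]]; exists (g * u), (h * u); split=> //; ring.
Qed.

(** A sequence regular on both ends of 0 -> R/(I : u) -> R/I -> R/(I + (u))
    -> 0 is regular in the middle. This plays the part of the depth lemma
    when one sequence serves all the ideals involved. *)
Lemma weakly_regular_exact I u s : ideal I ->
  weakly_regular (ideal_colon I u) s -> weakly_regular (add_principal I u) s ->
  weakly_regular I s.
Proof.
elim: s I => [|a s IH] I idI //= [nzdC regC] [nzdA regA]; split.
  move=> g Iag; have [_ ID IM] := idI.
  have /nzdA[i [h [Ii Eg]]] := sub_add_principal u Iag.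
  rewrite Eg; apply: ID => //; apply: nzdC; rewrite /ideal_colon /=.
  rewrite (_ : _ * u = a * g - a * i); last by rewrite Eg; ring.
  by apply: idealB => //; apply: IM.
apply: IH; first exact: ideal_add_principal.
  by rewrite colon_add_principal.
by rewrite add_principalC.
Qed.

Lemma weakly_regular_unit I s : ideal I -> I 1 -> weakly_regular I s.
Proof.
elim: s I => [|a s IH] I idI I1 //=; split.
  by move=> g _; have [_ _ IM] := idI; rewrite -[g]mulr1; apply: IM.
by apply: IH; [apply: ideal_add_principal | apply: sub_add_principal].
Qed.

(** An ideal maximal among those that contain J and avoid S is prime. Zorn's
    lemma is applied to the sets A whose union with J is such an ideal, so
    that the empty chain has the bound set0. *)
Lemma exists_prime_avoiding J S : ideal J ->
  S 1 -> (forall f g, S f -> S g -> S (f * g)) -> (forall f, J f -> ~ S f) ->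
  exists P, [/\ prime_ideal P, J `<=` P & forall f, P f -> ~ S f].
Proof.
move=> idJ S1 SM JS.
pose ok A := ideal (A `|` J) /\ forall f, (A `|` J) f -> ~ S f.
have [A [okA maxA]] : exists A, ok A /\ forall B, A `<` B -> ~ ok B.
  apply: Zorn_bigcup => F okF chF.
  have memU f : (\bigcup_(X in F) X `|` J) f <->
      J f \/ exists2 X, F X & (X `|` J) f.
    split=> [[[X FX Xf]|Jf]|[Jf|[X FX [Xf|Jf]]]]; try by [left|right].
      by right; exists X => //; left.
    by left; exists X.
  have [J0 JD JM] := idJ.
  split; last by move=> f /memU[/JS//|[X /okF[_ XS]]]; apply: XS.
  split; first by apply/memU; left.
    move=> f g /memU[Jf|[X FX Xf]] /memU[Jg|[Y FY Yg]]; apply/memU.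
    - by left; apply: JD.
    - right; exists Y => //; have [[_ YD _] _] := okF _ FY.
      by apply: YD => //; right.
    - right; exists X => //; have [[_ XD _] _] := okF _ FX.
      by apply: XD => //; right.
    - right; have [XY|YX] := chF _ _ FX FY.
        exists Y => //; have [[_ YD _] _] := okF _ FY.
        by apply: YD => //; case: Xf => [/XY|]; [left|right].
      exists X => //; have [[_ XD _] _] := okF _ FX.
      by apply: XD => //; case: Yg => [/YX|]; [left|right].
  move=> f g /memU[Jg|[Y FY Yg]]; apply/memU; first by left; apply: JM.
  right; exists Y => //; have [[_ _ YM] _] := okF _ FY; exact: YM.
have [idP PS] := okA; set P := A `|` J in idP PS.
have meets a : ~ P a -> exists2 f, add_principal P a f & S f.
  move=> nPa; apply: contrapT => nex.
  apply: (maxA (add_principal P a)).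
    split; last first.
      by move=> sub; apply/nPa; left; apply/sub/mem_add_principal.
    by move=> f Af; apply: sub_add_principal; left.
  rewrite /ok (_ : add_principal P a `|` J = add_principal P a); last first.
    apply/seteqP; split=> f; [case=> // Jf | by left].
    by apply: sub_add_principal; right.
  split; first exact: ideal_add_principal.
  by move=> f Pf Sf; apply: nex; exists f.
exists P; split=> //; last by move=> f; right.
split; first by split=> // /PS; apply.
move=> f g Pfg; apply: contrapT => /not_orP[/meets[_ [p [h [Pp ->]]] Sf]].
move=> /meets[_ [q [k [Pq ->]]] Sg].
have [_ PD PM] := idP.
apply: (PS _ _ (SM _ _ Sf Sg)).
have -> : (p + h * f) * (q + k * g) =
  ((q + k * g) * p + (h * f) * q) + (h * k) * (f * g) by ring.
by apply: (PD _ _ (PD _ _ _ _)); apply: (PM).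
Qed.

Lemma exists_prime_over I : ideal I -> ~ I 1 ->
  exists2 P, prime_ideal P & I `<=` P.
Proof.
move=> idI nI1; have [|_ _ -> ->||P [primeP IP _]] :=
    @exists_prime_avoiding I [set 1] idI.
- by [].
- by rewrite mulr1.
- by move=> f If Ef; apply: nI1; rewrite -Ef.
- by exists P.
Qed.

(** The prime avoids all a ^+ k * g with g outside Q: avoiding g gives P
    inside Q, and avoiding a is possible because a is regular modulo I. *)
Lemma prime_below I Q a : ideal I -> prime_ideal Q -> I `<=` Q ->
  (forall g, I (a * g) -> I g) ->
  exists P, [/\ prime_ideal P, I `<=` P, P `<=` Q & ~ P a].
Proof.
move=> idI [[[Q0 QD QM] nQ1] primeQ] IQ nzd.
pose S := [set f | exists g k, ~ Q g /\ f = a ^+ k * g].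
have nzdX k g : I (a ^+ k * g) -> I g.
  elim: k => [|k IH]; first by rewrite mul1r.
  by rewrite exprS -mulrA => /nzd.
have [|||P [primeP IP PS]] := @exists_prime_avoiding I S idI.
- by exists 1, 0%N; rewrite mulr1.
- move=> _ _ [f [k [nQf ->]]] [g [l [nQg ->]]].
  exists (f * g), (k + l)%N; split; last by rewrite exprD; ring.
  by move=> /primeQ[].
- by move=> f If [g [k [nQg Ef]]]; apply/nQg/IQ/(nzdX k); rewrite -Ef.
exists P; split=> //.
  move=> f Pf; apply: contrapT => nQf; apply: (PS _ Pf).
  by exists f, 0%N; rewrite mul1r.
by move=> /PS; apply; exists 1, 1%N; rewrite mulr1.
Qed.

Lemma prime_chain_cons I P0 (P : nat -> set R) d :
  prime_ideal P0 -> I `<=` P0 ->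
  (forall i, (i <= d)%N -> prime_ideal (P i) /\ I `<=` P i) ->
  (forall i, (i < d)%N -> P i `<` P i.+1) -> P0 `<` P 0%N ->
  prime_chain I d.+1.
Proof.
move=> primeP0 IP0 primeP ltP ltP0.
exists (fun i => if i is j.+1 then P j else P0); split=> [[|i]|[|i]] //.
  exact: primeP.
exact: ltP.
Qed.

(** Why depth is at most dimension: going down from a prime over the ideal
    generated by I and the whole sequence, each regular element leaves room
    for one strictly smaller prime. *)
Lemma weakly_regular_chain I s : ideal I -> weakly_regular I s ->
  ~ ideal_add I (ideal_gen [set` s]) 1 -> prime_chain I (size s).
Proof.
elim: s I => [|a s IH] I idI.
  rewrite ideal_add_gen0 // => _ /(exists_prime_over idI)[P primeP IP].
  by exists (fun=> P).
rewrite ideal_add_gen_cons //= => -[nzd reg] proper.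
have idIa := ideal_add_principal a idI.
have [P [primeP ltP]] := IH _ idIa reg proper.
have [primeP0 IaP0] := primeP 0%N isT.
have IP0 := subset_trans (@sub_add_principal I a) IaP0.
have [Q [primeQ IQ QP nQa]] := prime_below idI primeP0 IP0 nzd.
apply: (@prime_chain_cons I Q P) => //.
  move=> i /primeP[? IaP]; split=> //.
  exact: subset_trans (@sub_add_principal I a) IaP.
by split=> // /(_ a (IaP0 _ (mem_add_principal _ idI))).
Qed.

Lemma quot_dim_uniq I d e : quot_dim I d -> quot_dim I e -> d = e.
Proof.
by move=> [Id maxd] [Ie maxe]; apply/eqP; rewrite eqn_leq maxe ?maxd.
Qed.

End Ideals.
(** * Chains of primes in a polynomial ring *)

Section KrullDimension.
Context {K : fieldType} {n : nat}.

Lemma big_tuple_cons (V : nmodType) (T : finType) m (F : m.+1.-tuple T -> V) :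
  \sum_s F s = \sum_j \sum_(s : m.-tuple T) F [tuple of j :: s].
Proof.
rewrite pair_big /=.
rewrite (reindex (fun p : T * m.-tuple T => [tuple of p.1 :: p.2])) //=.
exists (fun s => (thead s, [tuple of behead s])) => [[j s] _|s _] /=.
  by congr pair; apply: val_inj.
by rewrite -tuple_eta.
Qed.

(** The exponents are a list of naturals, so that prepending an exponent
    matches shifting the chain of primes in [prime_chain_independent]. *)
Definition tuple_monomial (R : comNzRingType) (a : nat -> R) (s : seq nat) : R
  :=
  \prod_(i < size s) a i ^+ nth 0%N s i.

Lemma tuple_monomial_cons (R : comNzRingType) (a : nat -> R) j s :
  tuple_monomial a (j :: s) = a 0%N ^+ j * tuple_monomial (fun i => a i.+1) s.
Proof. by rewrite /tuple_monomial big_ord_recl. Qed.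

(** Elements picked from the steps of a chain of primes are algebraically
    independent. Order the relation by powers of a 0: if j is the lowest
    power whose coefficient g j is not known to vanish, dividing by a 0 ^+ j
    (which is allowed modulo P 0) leaves g j modulo a 0, hence g j lies in P
    1, and the shorter chain starting at P 1 applies to g j. *)
Lemma prime_chain_independent (N m : nat) (P : nat -> set {mpoly K[n]}) a
    (c : m.-tuple 'I_N -> K) :
  (forall i, (i <= m)%N -> prime_ideal (P i)) ->
  (forall i, (i < m)%N -> P i `<=` P i.+1) ->
  (forall i, (i < m)%N -> P i.+1 (a i) /\ ~ P i (a i)) ->
  P 0%N (\sum_s c s *: tuple_monomial a (map val s)) ->
  forall s, c s = 0.
Proof.
elim: m P a c => [|m IH] P a c primeP subP aP P0.
  move=> s; apply: contrapT => /eqP nz.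
  have [[[_ _ PM] nP1] _] := primeP 0%N isT.
  apply: nP1; rewrite (_ : 1 = (c s)^-1%:MP * (c s)%:MP); last first.
    by rewrite -mpolyCM mulVf // mpolyC1.
  apply: PM; move: P0; rewrite (big_pred1 s) => [|t]; last first.
    by rewrite (tuple0 t) (tuple0 s) /= eqxx.
  by rewrite /tuple_monomial tuple0 /= big_ord0 -mul_mpolyC mulr1.
pose g j := \sum_(s : m.-tuple 'I_N)
  c [tuple of j :: s] *: tuple_monomial (fun i => a i.+1) (map val s).
have P0' : P 0%N (\sum_(j < N) a 0%N ^+ j * g j).
  move: P0; rewrite big_tuple_cons; congr (P 0%N _).
  apply: eq_bigr => j _; rewrite mulr_sumr; apply: eq_bigr => s _.
  by rewrite /= tuple_monomial_cons scalerAr.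
have [[[_ _ P0M] nP01] primeP0] := primeP 0%N isT.
have [idP1 _] := (primeP 1%N isT).1.
have [P1a nP0a] := aP 0%N isT.
have nP0aX k f : P 0%N (a 0%N ^+ k * f) -> P 0%N f.
  elim: k => [|k IHk]; first by rewrite mul1r.
  by rewrite exprS -mulrA => /primeP0[/nP0a|/IHk].
suff gc (j : 'I_N) : forall s : m.-tuple 'I_N, c [tuple of j :: s] = 0.
  by move=> s; rewrite (tuple_eta s) gc.
have [k] := ubnP (val j); elim: k j => // k IHk j lt_jk.
apply: (IH (fun i => P i.+1) (fun i => a i.+1)
  (fun s : m.-tuple 'I_N => c [tuple of j :: s])).
- by move=> i lt_im; apply: primeP.
- by move=> i lt_im; apply: subP.
- by move=> i lt_im; apply: aP.
(* The powers of a 0 below j drop out; those above j give the multiple of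
   a 0. *)
rewrite -/(g j).
have g0 (i : 'I_N) : (i < j)%N -> g i = 0.
  move=> lt_ij; rewrite /g big1 // => s _.
  by rewrite IHk ?scale0r //; apply: leq_trans lt_ij _.
pose r := \sum_(i < N | (j < i)%N) a 0%N ^+ (i - j.+1) * g i.
have : P 0%N (a 0%N ^+ j * (g j + a 0%N * r)).
  move: P0'; congr (P 0%N _).
  rewrite (bigID (fun i : 'I_N => (i < j)%N)) /= big1 ?add0r; last first.
    by move=> i lt_ij; rewrite g0 ?mulr0.
  rewrite (bigD1 j) ?ltnn //= mulrDr; congr (_ + _).
  rewrite /r mulrA -exprSr mulr_sumr; apply: eq_big => [i|i].
    by rewrite -leqNgt ltn_neqAle eq_sym andbC.
  rewrite -leqNgt => /andP[le_ji ne_ij]; rewrite mulrA -exprD subnKC //.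
  by rewrite ltn_neqAle eq_sym le_ji andbT.
move=> /nP0aX /(subP 0%N isT) P1g.
have [_ _ P1M] := idP1.
have P1r : P 1%N (a 0%N * r) by rewrite mulrC; apply: P1M.
by have := idealB idP1 P1g P1r; rewrite addrK.
Qed.

Lemma msize_prod_le (T : Type) (r : seq T) (F : T -> {mpoly K[n]}) D :
  (forall i, (msize (F i) <= D)%N) ->
  (msize (\prod_(i <- r) F i) <= (size r * D.+1).+1)%N.
Proof.
move=> leF; elim: r => [|i r IH]; first by rewrite big_nil msize1.
rewrite big_cons /= mulSn; apply: leq_trans (msizeM_le _ _) _.
by rewrite ltnS addSnnS leq_add.
Qed.

Lemma msizeX_le (f : {mpoly K[n]}) D k :
  (msize f <= D)%N -> (msize (f ^+ k) <= (k * D.+1).+1)%N.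
Proof.
move=> lef; have := @msize_prod_le _ (nseq k tt) (fun=> f) D (fun=> lef).
by rewrite size_nseq big_const_seq count_nseq /= mul1n -Monoid.iteropE.
Qed.

Lemma msize_tuple_monomial N m D a (s : m.-tuple 'I_N) :
  (forall i, (i < m)%N -> (msize (a i : {mpoly K[n]}) <= D)%N) ->
  (msize (tuple_monomial a (map val s)) <= (m * (N * D.+1).+2).+1)%N.
Proof.
move=> lea; rewrite /tuple_monomial size_map size_tuple.
have := @msize_prod_le _ (index_enum 'I_m)
  (fun i : 'I_m => a i ^+ nth 0%N (map val s) i) (N * D.+1).+1.
rewrite [size _](_ : _ = m); last by rewrite -sum1_size sum1_card card_ord.
apply => i; apply: leq_trans (msizeX_le _ (lea i (ltn_ord i))) _.
rewrite ltnS leq_mul2r ltnW ?orbT //.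
by rewrite (nth_map (tnth s i)) ?size_tuple // ltn_ord.
Qed.

(** More than n polynomials in n variables are dependent by counting: the N ^
    m monomials in them with exponents below N have all exponents below C *
    N, with C not depending on N, so they live in a space of dimension (C *
    N) ^ n. As n < m, this is smaller than N ^ m once N exceeds C ^ n. *)
Lemma algebraic_dependence (m : nat) (a : nat -> {mpoly K[n]}) : (n < m)%N ->
  exists N (c : m.-tuple 'I_N -> K),
    \sum_s c s *: tuple_monomial a (map val s) = 0 /\ exists s, c s != 0.
Proof.
move=> lt_nm.
have [D leD] : exists D, forall i, (i < m)%N -> (msize (a i) <= D)%N.
  exists (\max_(i < m) msize (a i)) => i lt_im.
  exact: (@leq_bigmax _ (fun i : 'I_m => msize (a i)) (Ordinal lt_im)).
pose C := (m * D.+3).+1; pose N := (C ^ n).+1; pose B := (C * N)%N.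
have gt_mB (s : m.-tuple 'I_N) k : k \in msupp (tuple_monomial a (map val s)) ->
    forall i, (k i < B)%N.
  move=> /msize_mdeg_lt lt_k i.
  have : (k i <= mdeg k)%N by rewrite mdegE (bigD1 i) //= leq_addr.
  have := msize_tuple_monomial s leD; rewrite /B /C; move: lt_k; nia.
have card_lt : (B ^ n < N ^ m)%N.
  rewrite expnMn; apply: (@leq_trans (N * N ^ n)).
    by rewrite ltn_pmul2r ?expn_gt0.
  by rewrite -expnS leq_pexp2l.
pose T := m.-tuple 'I_N; pose U := {ffun 'I_n -> 'I_B}.
pose mon (u : U) := [multinom val (u i) | i < n].
pose A := \matrix_(i < #|{: T}|, j < #|{: U}|)
  (tuple_monomial a (map val (enum_val i : T)))@_(mon (enum_val j)).
have /rowV0Pn[v /sub_kermxP vA nzv] : kermx A != 0.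
  rewrite kermx_eq0 /row_free neq_ltn (leq_ltn_trans (rank_leq_col A)) //.
  by rewrite card_tuple card_ffun !card_ord.
exists N, (fun s => v 0 (enum_rank s)); split; last first.
  have [j nz] : exists j, v 0 j != 0.
    apply: contrapT => nex; move/eqP: nzv; apply; apply/rowP => j.
    by rewrite mxE; apply: contrapT => /eqP nz; apply: nex; exists j.
  by exists (enum_val j); rewrite enum_valK.
apply/mpolyP => k; rewrite mcoeff0 raddf_sum /=.
have [/forallP ltk|/forallPn[i nlt]] := boolP [forall i, k i < B]%N; last first.
  apply: big1 => s _; rewrite mcoeffZ memN_msupp_eq0 ?mulr0 //.
  by apply: contra nlt => /gt_mB.
pose u : U := [ffun i => Ordinal (ltk i)].
have Ek : k = mon u by apply/mnmP => i; rewrite mnmE ffunE.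
transitivity ((v *m A) 0 (enum_rank u)); last by rewrite vA mxE.
rewrite mxE (reindex (@enum_val _ {: T})) /=; last first.
  by apply: onW_bij; apply: enum_val_bij.
by apply: eq_bigr => i _; rewrite mcoeffZ enum_valK !mxE enum_rankK Ek.
Qed.

Lemma prime_chain_length (P : nat -> set {mpoly K[n]}) m :
  (forall i, (i <= m)%N -> prime_ideal (P i)) ->
  (forall i, (i < m)%N -> P i `<` P i.+1) -> (m <= n)%N.
Proof.
move=> primeP ltP; rewrite leqNgt; apply/negP => lt_nm.
have [a aP] : exists a, forall i, (i < m)%N -> P i.+1 (a i) /\ ~ P i (a i).
  have /choice[a aP] : forall i, exists f, (i < m)%N -> P i.+1 f /\ ~ P i f.
    move=> i; have [/ltP[_ nsub]|] := boolP (i < m)%N; last by exists 0.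
    apply: contrapT => nex; apply: nsub => f Pf; apply: contrapT => nPf.
    by apply: nex; exists f.
  by exists a.
have [N [c [c0 [s nz]]]] := algebraic_dependence a lt_nm.
move/eqP: nz; apply; apply: (@prime_chain_independent N m P a c) => //.
  by move=> i /ltP[].
by rewrite c0; have [[[]]] := primeP 0%N isT.
Qed.

End KrullDimension.
(** * Monomial ideals and their coordinate primes *)

Section Monomials.
Context {K : fieldType} {n : nat}.
Implicit Types (I J : set {mpoly K[n]}) (M : set 'X_{1..n}) (F G : {set 'I_n}).

Definition up_closed M : Prop := forall m m', M m -> M (m + m')%MM.

(** A monomial ideal is encoded by the set of exponents of its monomials,
    where colons and sums by a monomial become operations on sets of
    exponents. *)
Definition monomial_span M : set {mpoly K[n]} :=
  [set f | forall m, m \in msupp f -> M m].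

Definition exponent_colon M (u : 'X_{1..n}) : set 'X_{1..n} :=
  [set m | M (m + u)%MM].

Definition exponent_add M (u : 'X_{1..n}) : set 'X_{1..n} :=
  [set m | M m \/ (u <= m)%MM].

Lemma up_closed_le M m m' : up_closed M -> (m <= m')%MM -> M m -> M m'.
Proof. by move=> upM lemm' Mm; rewrite -(submK lemm') addmC; apply: upM. Qed.

Lemma up_closed_colon M u : up_closed M -> up_closed (exponent_colon M u).
Proof.
move=> upM m m' Mm; rewrite /exponent_colon /= -addmA (addmC m') addmA.
exact: upM.
Qed.

Lemma up_closed_add M u : up_closed M -> up_closed (exponent_add M u).
Proof.
move=> upM m m' [Mm|leum]; [by left; apply: upM | right].
exact: lepm_trans leum (lem_addr _ _).
Qed.

Lemma ideal_monomial_span M : up_closed M -> ideal (monomial_span M).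
Proof.
move=> upM; split.
- by move=> m; rewrite msupp0.
- move=> f g Mf Mg m /msuppD_le; rewrite mem_cat => /orP[/Mf|/Mg] //.
- move=> f g Mg m /msuppM_le/allpairsP[[m1 m2] /= [_ /Mg Mm2 ->]].
  by rewrite addmC; apply: upM.
Qed.

Lemma monomial_spanX M m : monomial_span M 'X_[m] <-> M m.
Proof.
by split=> [|Mm k]; [apply | ]; rewrite msuppX mem_seq1 // => /eqP->.
Qed.

Lemma monomial_span_sub M J :
  ideal J -> (forall m, M m -> J 'X_[m]) -> monomial_span M `<=` J.
Proof.
move=> idJ MJ f Mf; rewrite [f]mpolyE big_seq; apply: ideal_sum => // m /Mf Mm.
by have [_ _ JM] := idJ; rewrite -mul_mpolyC; apply/JM/MJ.
Qed.

Lemma monomial_idealP I : monomial_ideal I ->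
  exists2 M, up_closed M & I = monomial_span M.
Proof.
case=> S ->; set J := ideal_gen _; have idJ : ideal J by apply: ideal_ideal_gen.
have upM : up_closed [set m | J 'X_[m]].
  by move=> m m' Jm; have [_ _ JM] := idJ; rewrite /= mpolyXD mulrC; apply: JM.
exists [set m | J 'X_[m]] => //.
apply/seteqP; split; last exact: monomial_span_sub.
apply: ideal_gen_sub; first exact: ideal_monomial_span.
by move=> _ [m Sm <-]; apply/monomial_spanX; apply: mem_ideal_gen; exists m.
Qed.

Lemma monomial_span_colon M u :
  ideal_colon (monomial_span M) 'X_[u] = monomial_span (exponent_colon M u).
Proof.
apply/seteqP; split=> f Mf m.
  by rewrite mcoeff_msupp -(mcoeffMX _ u) addmC -mcoeff_msupp => /Mf.
by rewrite (perm_mem (msuppMX _ _)) => /mapP[k /Mf Mk ->]; rewrite addmC.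
Qed.

Lemma monomial_span_add M u : up_closed M ->
  add_principal (monomial_span M) 'X_[u] = monomial_span (exponent_add M u).
Proof.
move=> upM; have idM := ideal_monomial_span upM; apply/seteqP; split.
  apply: add_principal_sub; first exact/ideal_monomial_span/up_closed_add.
    by move=> f Mf m /Mf; left.
  by apply/monomial_spanX; right; apply: lepm_refl.
have idA := ideal_add_principal 'X_[u] idM; have [_ _ AM] := idA.
apply: monomial_span_sub => // m [Mm|leum].
  by apply: sub_add_principal; apply/monomial_spanX.
by rewrite -(submK leum) mpolyXD; apply/AM/mem_add_principal.
Qed.

Lemma eq_monomial_span M M' : (forall m, M m <-> M' m) ->
  monomial_span M = monomial_span M'.
Proof. by move=> MM'; congr monomial_span; apply/seteqP; split=> m /MM'. Qed.

Definition hits F : set 'X_{1..n} := [set m | exists2 i, i \in F & m i != 0%N].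

(** The prime generated by the variables with index in F. *)
Definition coordinate_prime F : set {mpoly K[n]} := monomial_span (hits F).

Lemma up_closed_hits F : up_closed (hits F).
Proof.
by move=> m m' [i Fi nz]; exists i => //; rewrite mnmDE addn_eq0 negb_and nz.
Qed.

Lemma ideal_coordinate_prime F : ideal (coordinate_prime F).
Proof. exact/ideal_monomial_span/up_closed_hits. Qed.

Lemma coordinate_primeX F i : coordinate_prime F 'X_i <-> i \in F.
Proof.
rewrite /coordinate_prime monomial_spanX /hits /=.
split=> [[j Fj]|Fi]; last by exists i; rewrite // mnm1E eqxx.
by rewrite mnm1E; have [->|] := eqVneq i j.
Qed.

Definition kill_value F i : {mpoly K[n]} := if i \in F then 0 else 'X_i.

(** Setting the variables of F to zero; coordinate_prime F is its kernel,
    hence prime because the polynomial ring is a domain. *)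
Definition kill F : {mpoly K[n]} -> {mpoly K[n]} :=
  mmap (@mpolyC n K) (kill_value F).

Lemma killX_hits F m : hits F m -> mmap1 (kill_value F) m = 0.
Proof.
case=> i Fi nz.
by rewrite /mmap1 /kill_value (bigD1 i) //= Fi expr0n (negPf nz) mul0r.
Qed.

Lemma killX_id F m : ~ hits F m -> mmap1 (kill_value F) m = 'X_[m].
Proof.
move=> nhit; rewrite [RHS]mpolyXE_id; apply: eq_bigr => i _.
rewrite /kill_value; case: ifP => // Fi.
have -> : m i = 0%N; last by rewrite !expr0.
by apply: contrapT => /eqP nz; apply: nhit; exists i.
Qed.

(** Both sides are governed by f - kill F f: monomial by monomial, the
    substitution erases what lies in the ideal and keeps the rest. *)
Lemma coordinate_primeE F f : coordinate_prime F f <-> kill F f = 0.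
Proof.
have [P0 PD PM] := ideal_coordinate_prime F.
split=> [Ff|f0].
  by rewrite /kill /mmap big_seq big1 // => m /Ff/killX_hits->; rewrite mulr0.
suff : coordinate_prime F (f - kill F f) by rewrite f0 subr0.
elim/mpolyind: f {f0} => [|c m f _ _ IH]; rewrite /kill.
  by rewrite mmap0 subr0.
rewrite mmapD mmapZ mmapX -mul_mpolyC opprD addrACA -mulrBr.
apply: (PD) => //; apply: (PM); have [hit|/killX_id->] := pselect (hits F m).
  by rewrite killX_hits // subr0; apply/monomial_spanX.
by rewrite subrr.
Qed.

Lemma prime_coordinate_prime F : prime_ideal (coordinate_prime F).
Proof.
split; first split; first exact: ideal_coordinate_prime.
  by rewrite -mpolyX0 => /monomial_spanX[i _]; rewrite mnm0E.
move=> f g; rewrite !coordinate_primeE /kill rmorphM => /eqP.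
by rewrite mulf_eq0 => /orP[/eqP|/eqP]; [left|right].
Qed.

Lemma coordinate_prime_sub F G :
  F \subset G -> coordinate_prime F `<=` coordinate_prime G.
Proof.
by move=> /fintype.subsetP FG f Ff m /Ff[i /FG]; exists i.
Qed.

Lemma coordinate_prime_proper F i :
  i \notin F -> coordinate_prime F `<` coordinate_prime (i |: F).
Proof.
move=> nFi; split; first exact/coordinate_prime_sub/finset.subsetUr.
move=> /(_ 'X_i); rewrite !coordinate_primeX => sub.
by move: nFi; rewrite sub // finset.setU11.
Qed.

(** A chain above coordinate_prime F can be prolonged downwards by removing
    the variables of F one at a time, so that the bound n on all chains
    suffices. *)
Lemma prime_chain_coordinate_le F e :
  prime_chain (coordinate_prime F) e -> (e + #|F| <= n)%N.
Proof.
have [k] := ubnP #|F|; elim: k => // k IH in F e *.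
have [->|[i Fi]] := set_0Vmem F => lt_k chain.
  rewrite cards0 addn0; have [P [primeP ltP]] := chain.
  by apply: (@prime_chain_length K n P) => // i /primeP[].
rewrite (cardsD1 i) Fi addnA addn1; apply: IH.
  by move: lt_k; rewrite (cardsD1 i) Fi.
have [P [primeP ltP]] := chain.
have lti : coordinate_prime (F :\ i) `<` coordinate_prime F.
  rewrite -[in X in _ `<` X](finset.setD1K Fi).
  by apply: coordinate_prime_proper; rewrite !inE eqxx.
apply: (@prime_chain_cons _ _ (coordinate_prime (F :\ i)) P) => //.
- exact: prime_coordinate_prime.
- move=> j /primeP[? sub]; split=> //.
  exact: subset_trans (proj1 lti) sub.
- have [_ sub0] := primeP 0%N isT; have [sub nsub] := lti.
  by split; [apply: subset_trans sub sub0 | move/(subset_trans sub0)].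
Qed.

Lemma prime_chain_coordinate F : prime_chain (coordinate_prime F) (n - #|F|).
Proof.
have [k] := ubnP (n - #|F|)%N; elim: k => // k IH in F *.
have [->|ne] := eqVneq F [set: 'I_n]%SET => lt_k.
  rewrite finset.cardsT card_ord subnn.
  exists (fun=> coordinate_prime [set: 'I_n]%SET); split=> // i _.
  by split=> //; apply: prime_coordinate_prime.
have [i nFi] : exists i, i \notin F.
  apply/existsP; apply: contraNT ne; rewrite negb_exists => /forallP all.
  by apply/eqP/setP => i; rewrite inE; apply/negPn.
have card_i : #|i |: F| = #|F|.+1 by rewrite cardsU1 nFi.
have le_n : (#|F|.+1 <= n)%N.
  by rewrite -card_i -[leqRHS]card_ord max_card.
have [|P [primeP ltP]] := IH (i |: F); first by rewrite card_i; lia.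
rewrite -(subnSK le_n) -card_i.
have [sub nsub] := coordinate_prime_proper nFi.
apply: (@prime_chain_cons _ _ (coordinate_prime F) P) => //.
- exact: prime_coordinate_prime.
- move=> j /primeP[? subj]; split=> //; exact: subset_trans sub subj.
- have [_ sub0] := primeP 0%N isT.
  by split; [apply: subset_trans sub sub0 | move/(subset_trans sub0)].
Qed.

Lemma quot_dim_coordinate_prime F : quot_dim (coordinate_prime F) (n - #|F|).
Proof.
split; first exact: prime_chain_coordinate.
by move=> e /prime_chain_coordinate_le; lia.
Qed.

End Monomials.
(** * Elementary symmetric polynomials as a regular sequence *)

Section ElementarySymmetrics.
Context {K : fieldType} {n : nat}.
Implicit Types (I J : set {mpoly K[n]}) (M : set 'X_{1..n}) (F G : {set 'I_n}).

(** The elementary symmetric polynomials in all n variables, from degree d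
    down to degree 1. The decreasing order lets the product of all the
    surviving variables come first in [weakly_regular_coordinate_prime]. *)
Fixpoint elementary_symmetrics d : seq {mpoly K[n]} :=
  if d is d'.+1 then mesym n K d :: elementary_symmetrics d' else [::].

Lemma size_elementary_symmetrics d : size (elementary_symmetrics d) = d.
Proof. by elim: d => //= d ->. Qed.

Lemma elementary_symmetrics_max_ideal d :
  [set` elementary_symmetrics d] `<=` @max_ideal K n.
Proof.
have idm : ideal (@max_ideal K n) := ideal_ideal_gen _.
elim: d => //= d IH f; rewrite /= inE => /predU1P[->|/IH //].
apply: ideal_sum => // h /eqP card_h.
have [i hi] : exists i, i \in h by apply/card_gt0P; rewrite card_h.
by apply: (ideal_prod idm hi); apply: mem_ideal_gen; exists i.
Qed.

Lemma max_ideal_coordinate :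
  @max_ideal K n `<=` coordinate_prime [set: 'I_n]%SET.
Proof.
apply: ideal_gen_sub; first exact: ideal_coordinate_prime.
by move=> _ [i _ <-]; apply/coordinate_primeX; rewrite inE.
Qed.

(** A set of #|~: F| variables other than ~: F meets F, so only one term
    survives. *)
Lemma mesym_coordinate_prime F :
  coordinate_prime F (mesym n K #|~: F| - 'X_[mesym1 (~: F)]).
Proof.
have idF := @ideal_coordinate_prime K n F.
rewrite mesymE (bigD1 (~: F)%SET) //= [X in X - _]addrC addrK.
apply: ideal_sum => // h /andP[/eqP card_h ne_h].
apply/monomial_spanX; apply: contrapT => nhit.
move/eqP: ne_h; apply; apply/eqP; rewrite eqEcard card_h leqnn andbT.
apply/fintype.subsetP => i hi; rewrite inE; apply/negP => Fi.
by apply: nhit; exists i => //; rewrite mnmE hi.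
Qed.

Lemma lem_mesym1 G m :
  (mesym1 G <= m)%MM <-> forall i, i \in G -> m i != 0%N.
Proof.
split=> [/mnm_lepP le i Gi|nz]; last apply/mnm_lepP => i.
  by have := le i; rewrite mnmE Gi lt0n.
by rewrite mnmE; case: (boolP (i \in G)) => // /nz; rewrite lt0n.
Qed.

(** Splitting off one variable 'X_j of the product: the colon by 'X_j removes
    j from G, and adding 'X_j gives the coordinate prime of j |: F. *)
Lemma weakly_regular_coordinate_product F G s :
  (forall i, i \in G -> i \notin F) ->
  (forall i, i \in G -> weakly_regular (@coordinate_prime K n (i |: F)) s) ->
  weakly_regular (add_principal (coordinate_prime F) 'X_[mesym1 G]) s.
Proof.
have upF : up_closed (hits F) := @up_closed_hits n F.
have [k] := ubnP #|G|; elim: k => // k IH in G *; move=> lt_k GF reg.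
have idG := ideal_add_principal 'X_[mesym1 G] (@ideal_coordinate_prime K n F).
have [G0|[j Gj]] := set_0Vmem G.
  apply: weakly_regular_unit => //.
  rewrite -mpolyX0 -mesym1_set0 -G0.
  exact/mem_add_principal/ideal_coordinate_prime.
have upG := up_closed_add (u := mesym1 G) upF.
apply: (@weakly_regular_exact _ _ 'X_j) => //;
  rewrite /coordinate_prime monomial_span_add //.
  rewrite monomial_span_colon (@eq_monomial_span _ _ _
    (exponent_add (hits F) (mesym1 (G :\ j)))); last first.
    have nz i m : i != j -> ((m + U_(j))%MM i != 0%N) = (m i != 0%N).
      by rewrite eq_sym mnmDE mnm1E => /negPf->; rewrite addn0.
    move=> m; rewrite /exponent_colon /exponent_add /= !lem_mesym1.
    split=> -[[i Fi mi]|mG]; [left | right | left | right].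
    - by exists i; rewrite // -(nz i m) //; apply: contraNneq (GF _ Gj) => <-.
    - by move=> i; rewrite !inE => /andP[ne /mG]; rewrite (nz i m).
    - by exists i; rewrite // (nz i m) //; apply: contraNneq (GF _ Gj) => <-.
    - move=> i Gi; have [->|ne] := eqVneq i j.
        by rewrite mnmDE mnm1E eqxx addn1.
      by rewrite nz // mG // !inE ne.
  rewrite -monomial_span_add //; apply: IH.
  - by move: lt_k; rewrite (cardsD1 j G) Gj.
  - by move=> i; rewrite !inE => /andP[_ /GF].
  - by move=> i; rewrite !inE => /andP[_ /reg].
rewrite monomial_span_add // (@eq_monomial_span _ _ _ (hits (j |: F))).
  exact: reg.
move=> m; rewrite /exponent_add /= lem_mesym1 lep1mP; split.
  case=> [[[i Fi mi]|/(_ j Gj) mj]|mj].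
  - by exists i; rewrite // !inE Fi orbT.
  - by exists j; rewrite // finset.setU11.
  - by exists j; rewrite // finset.setU11.
case=> i /[!inE] /predU1P[->|Fi] mi; first by right.
by left; left; exists i.
Qed.

(** The quotient is a polynomial ring in d variables, in which the first
    element is the product of the variables. It is regular, and modulo it the
    ring is filtered by polynomial rings in d - 1 variables, to which the
    induction hypothesis applies since the restrictions are again elementary
    symmetric. *)
Lemma weakly_regular_coordinate_prime F d : (#|F| + d = n)%N ->
  weakly_regular (coordinate_prime F) (elementary_symmetrics d).
Proof.
elim: d => //= d IH in F *; move=> card_F.
have card_CF : #|(~: F)%SET| = d.+1.
  by apply/eqP; rewrite -(eqn_add2l #|F|) cardsC card_ord card_F.
have congr_mesym := @mesym_coordinate_prime F; rewrite card_CF in congr_mesym.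
have idF := @ideal_coordinate_prime K n F.
have [_ primeF] := @prime_coordinate_prime K n F.
split.
  move=> g /primeF[Fe|//]; exfalso.
  have := idealB idF Fe congr_mesym.
  rewrite opprB addrC subrK => /monomial_spanX.
  by case=> i Fi; rewrite mnmE inE Fi.
rewrite (add_principal_congr idF congr_mesym).
apply: weakly_regular_coordinate_product => i; rewrite inE // => nFi.
by apply: IH; rewrite cardsU1 nFi addSnnS.
Qed.

End ElementarySymmetrics.

(** * Primary monomial ideals *)

Section PrimaryMonomial.
Context {K : fieldType} {n : nat}.
Implicit Types (I : set {mpoly K[n]}) (M : set 'X_{1..n}) (F : {set 'I_n}).

Definition restrict F (m : 'X_{1..n}) : 'X_{1..n} :=
  [multinom if i \in F then m i else 0%N | i < n].

(** The monomial ideals that are primary to coordinate_prime F, together with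
    the unit ideal: they are generated by monomials in the variables of F,
    and contain a power of each of these variables. *)
Definition primary_exponents F M : Prop :=
  [/\ up_closed M, forall m, M m -> M (restrict F m) &
      forall i, i \in F -> exists a, M (U_(i) *+ a)%MM].

(** Reduction of primary monomial ideals down to their radical, along colon
    and sum by a variable of F not yet in the ideal. Both operations lower
    the sum of exponents a i such that 'X_i ^+ a i lies in the ideal: the
    colon subtracts 1 from one a i, and the sum lowers it to 1. *)
Lemma primary_exponents_ind F (Q : set 'X_{1..n} -> Prop) :
  (forall M, primary_exponents F M -> M 0%MM -> Q M) ->
  Q (hits F) ->
  (forall M i, primary_exponents F M -> i \in F -> ~ M U_(i)%MM ->
    Q (exponent_colon M U_(i)) -> Q (exponent_add M U_(i)) -> Q M) ->
  forall M, primary_exponents F M -> Q M.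
Proof.
move=> Q1 QF QS M primM; have [_ _ powM] := primM.
have /choice[a aM] : forall i, exists a, i \in F -> M (U_(i) *+ a)%MM.
  by move=> i; have [/powM[a Ma]|] := boolP (i \in F); [exists a | exists 0%N].
have [N] := ubnP (\sum_(i in F) a i).
elim: N => // N IH in M a primM aM {powM} *; move=> lt_N.
have [upM resM powM] := primM.
have [M0|nM0] := pselect (M 0%MM); first exact: Q1.
have [[i [Fi nMi]]|allM] :=
  pselect (exists i, i \in F /\ ~ M U_(i)%MM); last first.
  (* All the variables of F are in the ideal, which is then the prime. *)
  suff -> : M = hits F by [].
  apply/seteqP; split=> m.
    move=> /resM Mr; apply: contrapT => nhit; apply: nM0.
    rewrite (_ : 0%MM = restrict F m) //; apply/mnmP => i.
    rewrite mnm0E mnmE; case: ifP => // Fi; apply: esym.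
    apply: contrapT => /eqP nz.
    by apply: nhit; exists i.
  case=> i Fi nz; apply: (@up_closed_le _ _ U_(i)) => //.
    by rewrite lep1mP.
  by apply: contrapT => nMi; apply: allM; exists i.
have gt1 : (1 < a i)%N.
  have := aM i Fi; case: (a i) => [|[|//]]; first by rewrite mulm0n.
  by rewrite mulm1n.
have ltsum b : (b i < a i)%N -> (forall j, j != i -> b j = a j) ->
    (\sum_(j in F) b j < N)%N.
  move=> lt_b eq_b; move: lt_N.
  rewrite (bigD1 i) //= [X in (X < N)%N](bigD1 i) //=.
  rewrite ltnS; apply: leq_trans; rewrite -addSn leq_add //.
  by apply/eq_leq/eq_bigr => j /andP[_ /eq_b].
apply: (QS M i) => //.
  pose b j := if j == i then (a i).-1 else a j.
  have bM j : j \in F -> exponent_colon M U_(i)%MM (U_(j) *+ b j)%MM.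
    rewrite /b; case: eqP => [->|_] Fj; last by apply: upM; apply: aM.
    by rewrite /exponent_colon /= -mulmSr prednK ?(ltnW gt1) //; apply: aM.
  apply: (IH _ b) => //; last first.
    apply: ltsum => [|j /negPf ne]; rewrite /b ?ne //.
    by rewrite eqxx prednK // ltnW.
  split; [exact: up_closed_colon | | by move=> j Fj; exists (b j); apply: bM].
  move=> m /resM; rewrite /exponent_colon /=.
  rewrite (_ : restrict F _ = restrict F m + U_(i))%MM //.
  apply/mnmP => j; rewrite !(mnmE, mnmDE, mnm1E).
  by case: (boolP (j \in F)) => // nFj; case: eqP nFj => // <-; rewrite Fi.
pose b j := if j == i then 1%N else a j.
have bM j : j \in F -> exponent_add M U_(i)%MM (U_(j) *+ b j)%MM.
  rewrite /b; case: eqP => [->|_] Fj; last by left; apply: aM.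
  by right; rewrite mulm1n lepm_refl.
apply: (IH _ b) => //; last first.
  by apply: ltsum => [|j /negPf ne]; rewrite /b ?eqxx ?ne.
split; [exact: up_closed_add | | by move=> j Fj; exists (b j); apply: bM].
move=> m [/resM Mr|]; [by left | rewrite lep1mP => nz; right].
by rewrite lep1mP mnmE Fi.
Qed.

Lemma weakly_regular_primary_exponents F s M : primary_exponents F M ->
  weakly_regular (@coordinate_prime K n F) s ->
  weakly_regular (@monomial_span K n M) s.
Proof.
move=> primM reg; elim/(primary_exponents_ind (F := F)): M / primM => //.
  move=> M [upM _ _] M0; apply: weakly_regular_unit.
    exact: ideal_monomial_span.
  by rewrite -mpolyX0; apply/monomial_spanX.
move=> M i [upM _ _] _ _ regC regA.
apply: (@weakly_regular_exact _ _ 'X_i); first exact: ideal_monomial_span.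
  by rewrite monomial_span_colon.
by rewrite monomial_span_add.
Qed.

Lemma primary_exponents_colon F M : primary_exponents F M -> ~ M 0%MM ->
  exists u, ideal_colon (@monomial_span K n M) u = coordinate_prime F.
Proof.
move=> primM; elim/(primary_exponents_ind (F := F)): M / primM => //.
  move=> _; exists 1; apply/seteqP.
  by split=> f; rewrite /ideal_colon /= mulr1.
move=> M i _ _ nMi IH _ _; have [|u Eu] := IH.
  by rewrite /exponent_colon /= add0m.
by exists (u * 'X_i); rewrite -ideal_colonM monomial_span_colon.
Qed.

(** The radical of a primary ideal is prime, so it contains a factor of each
    monomial that it contains. *)
Lemma radical_primary_monomial I m : primary_ideal I -> radical I 'X_[m] ->
  exists2 i, m i != 0%N & radical I 'X_i.
Proof.
move=> primI; have [[idI nI1] _] := primI.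
have nrad1 : ~ radical I 1 by case=> k; rewrite expr1n.
rewrite mpolyXE_id; elim: (index_enum _) => [|i r IH].
  by rewrite big_nil.
rewrite big_cons => /(radical_primary primI)[[k]|]; last exact: IH.
rewrite -exprM => Ik; exists i; last by exists (m i * k)%N.
by apply: contraPneq Ik => ->; rewrite mul0n expr0.
Qed.

(** F is the set of variables in the radical. If a monomial lies in I, its
    factor in the other variables has no power in I, so its factor in the
    variables of F lies in I. *)
Lemma primary_monomialP I : monomial_ideal I -> primary_ideal I ->
  exists F M, [/\ I = monomial_span M, primary_exponents F M & ~ M 0%MM].
Proof.
move=> /monomial_idealP[M upM EI] primI; have [[idI nI1] IP] := primI.
pose F := [set i : 'I_n | `[< radical I 'X_i >]]%SET.
exists F, M; split=> //; last first.
  by move=> M0; apply: nI1; rewrite EI -mpolyX0; apply/monomial_spanX.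
split=> // [m Mm|i]; last first.
  rewrite inE => /asboolP[a Ia]; exists a.
  by move: Ia; rewrite EI mpolyXn => /monomial_spanX.
have Em : m = (restrict F m + restrict (~: F) m)%MM.
  apply/mnmP => i; rewrite mnmDE !mnmE !inE.
  by case: asboolP; rewrite ?addn0.
have : I 'X_[m] by rewrite EI; apply/monomial_spanX.
rewrite {1}Em mpolyXD => /IP[|/(radical_primary_monomial primI)[i]].
  by rewrite EI => /monomial_spanX.
by rewrite mnmE !inE; case: asboolP.
Qed.

Lemma ass_primary_exponents F M : primary_exponents F M -> ~ M 0%MM ->
  ass (@monomial_span K n M) (coordinate_prime F).
Proof.
move=> primM nM0; split; first exact: prime_coordinate_prime.
by have [u Eu] := primary_exponents_colon primM nM0; exists u.
Qed.

End PrimaryMonomial.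

(** * Ass-decomposable ideals *)

Section AssDecomposable.
Context {K : fieldType} {n : nat}.
Implicit Type I : set {mpoly K[n]}.

(** Along the sums I + (x_i^k) a decomposition reaches a primary ideal, and
    the associated primes found there are associated to I. *)
Lemma ass_decomposable_has_coordinate_prime I : ass_decomposable I ->
  exists F, ass I (coordinate_prime F).
Proof.
elim=> {I} [I monI primI|I i k _ _ _ _ Eass _ [F assF] _ _].
  have [F [M [-> primM nM0]]] := primary_monomialP monI primI.
  by exists F; apply: ass_primary_exponents.
by exists F; move: assF; rewrite Eass => -[].
Qed.

(** The associated primes of I : x^k are always among those of I, and those
    of I + (x^k) are so by the definition of ass-decomposability. Hence all
    the primary ideals at the end of the decomposition have dimension d, and
    one sequence is regular for all of them. *)
Lemma weakly_regular_ass_decomposable I d : ass_decomposable I ->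
  (forall P, ass I P -> quot_dim P d) ->
  weakly_regular I (elementary_symmetrics d).
Proof.
elim=> {I} [I monI primI|I i k monI [idI _] _ _ Eass _ IHA _ IHC] dimI.
  have [F [M [EI primM nM0]]] := primary_monomialP monI primI.
  rewrite EI in dimI *.
  apply: (weakly_regular_primary_exponents (F := F)) => //.
  apply: weakly_regular_coordinate_prime.
  have := quot_dim_uniq (quot_dim_coordinate_prime F)
            (dimI _ (ass_primary_exponents primM nM0)).
  by move=> <-; rewrite subnKC // -[leqRHS]card_ord max_card.
apply: (@weakly_regular_exact _ _ ('X_i ^+ k)) => //.
  by apply: IHC => P /ass_colon; apply: dimI.
rewrite -ideal_add_gen1 //; apply: IHA => P.
by rewrite Eass => -[assP _]; apply: dimI.
Qed.

End AssDecomposable.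

Theorem corollary3p8 (K : fieldType) (n : nat) (I : set {mpoly K[n]}) :
  monomial_ideal I -> unmixed I -> ass_decomposable I -> cohen_macaulay I.
Proof.
move=> monI unmixedI decI.
have idI : ideal I by case: monI => M ->; apply: ideal_ideal_gen.
have [F assF] := ass_decomposable_has_coordinate_prime decI.
pose d := (n - #|F|)%N.
have dimI : quot_dim I d by apply/(unmixedI _ assF)/quot_dim_coordinate_prime.
exists d; split=> //; split; last first.
  move=> _ [s [<- _ /(regular_seqE _ idI)[reg proper]]].
  by apply: (proj2 dimI); apply: weakly_regular_chain.
exists (elementary_symmetrics d); split.
- exact: size_elementary_symmetrics.
- exact: elementary_symmetrics_max_ideal.
apply/(regular_seqE _ idI); split.
  apply: weakly_regular_ass_decomposable => // P assP.
  exact/(unmixedI _ assP).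
have [[idT nT1] _] := @prime_coordinate_prime K n [set: 'I_n]%SET.
move=> gen1; apply: nT1; move: gen1; apply: ideal_add_sub => //.
  apply: subset_trans (ass_sub idI assF) _.
  by apply: coordinate_prime_sub; apply/fintype.subsetP => i _; rewrite inE.
apply: ideal_gen_sub => //.
apply: (subset_trans (@elementary_symmetrics_max_ideal K n d)).
exact: max_ideal_coordinate.
Qed.
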